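(* The number of rank-3 matroids on ground set $[n]=\{1,\dots,n\}$ that have no minor isomorphic to $\mathcal{W}^3$ or to $M(K_4)$ is $2^{o(n^2)}$ as $n\to\infty$.
   Context: $\mathcal{W}^3$ is the rank-3 whirl: the rank-3 matroid on a 6-element set $\{a,b,c,d,e,f\}$ whose only dependent 3-sets are $\{a,b,c\},\{c,d,e\},\{e,f,a\}$. $M(K_4)$ is the cycle matroid of $K_4$; equivalently the rank-3 matroid on $\{a,b,c,d,e,f\}$ whose only dependent 3-sets are $\{a,b,c\},\{c,d,e\},\{e,f,a\},\{b,d,f\}$. Matroids are counted as labelled matroids on $[n]$. *)

(* Defs.v *)
From mathcomp Require Import all_boot.
Set Implicit Arguments. Unset Strict Implicit. Unset Printing Implicit Defensive.

Definition is_matroid (T : finType) (F : {set {set T}}) : bool :=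
  [&& set0 \in F,
      [forall I in F, forall J : {set T}, (J \subset I) ==> (J \in F)] &
      [forall I in F, forall J in F,
         (#|I| < #|J|) ==> [exists x in J :\: I, (x |: I) \in F]]].

Definition rk (T : finType) (F : {set {set T}}) (X : {set T}) : nat :=
  \max_(I in F | I \subset X) #|I|.

(* M has a minor isomorphic to the matroid N on 'I_6 (given by its
   independent sets): there are a contraction set C and an injection
   f : 'I_6 -> T whose image avoids C (the deleted set is the rest), such
   that the rank function of M / C restricted to the image of f,
   X |-> r_M(X u C) - r_M(C), corresponds under f to the rank of N. *)
Definition has_minor6 (T : finType) (M : {set {set T}}) (N : {set {set 'I_6}}) : bool :=
  [exists C : {set T}, exists f : {ffun 'I_6 -> T},
     [&& injectiveb f, [disjoint (f @: setT) & C] &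
         [forall X : {set 'I_6}, rk M ((f @: X) :|: C) == rk N X + rk M C]]].

Definition oI6 (k : nat) : 'I_6 := inord k.
Definition trip (i j k : nat) : {set 'I_6} := [set oI6 i; oI6 j; oI6 k].

Definition W3 : {set {set 'I_6}} :=
  [set I : {set 'I_6} | (#|I| <= 3) &&
     (I \notin [:: trip 0 1 2; trip 2 3 4; trip 4 5 0])].

Definition MK4 : {set {set 'I_6}} :=
  [set I : {set 'I_6} | (#|I| <= 3) &&
     (I \notin [:: trip 0 1 2; trip 2 3 4; trip 4 5 0; trip 1 3 5])].

Definition count_excl (n : nat) : nat :=
  #|[set F : {set {set 'I_n}} | [&& is_matroid F, rk F setT == 3,
        ~~ has_minor6 F W3 & ~~ has_minor6 F MK4]]|.

(* Main.v *)
Require Import Defs.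
From mathcomp Require Import all_boot.
From mathcomp Require Import zify.
Set Implicit Arguments. Unset Strict Implicit. Unset Printing Implicit Defensive.

(* A rank-3 matroid is determined by its loops and parallel classes and by the
   long lines (with at least 3 points) of its simplification. Excluding W^3 and
   M(K_4) means that no three long lines form a triangle. Joining each point of
   each long line cyclically to the next two points then gives a linear,
   triangle-free tripartite 3-graph whose number of edges is the sum of the
   lengths of the long lines; by the Ruzsa-Szemeredi theorem this is o(n^2).

   For each long line fix two base points u, v. The triples (u, v, w), with w
   on the line, determine all the lines, and by triangle-freeness their set is
   determined by its three projections to pairs. So the matroid is encoded by a
   map from [n] to [n] + {loop} and three sets of o(n^2) pairs: 2^{o(n^2)} choices.

   The Ruzsa-Szemeredi theorem is proved without a regularity lemma: repeatedly
   remove rectangles of positive relative area containing few edges from a union of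
   cells of a partition that covers almost all the edges; the area decreases by
   a constant proportion of n^2 at each step. *)

(** * Corner-free sets of triples *)

Lemma card_fibers (U C : finType) (f : U -> C) (A : {set U}) :
  #|A| = \sum_c #|[set x in A | f x == c]|.
Proof.
rewrite -sum1_card (partition_big f predT) //=.
by apply: eq_bigr => c _; rewrite -sum1_card; apply: eq_bigl => x; rewrite inE.
Qed.

(* The triples are the edges of a tripartite 3-graph on three copies of T; the
   condition says that it is linear and contains no triangle. *)
Definition corner_free (T : finType) (H : {set T * T * T}) : Prop :=
  forall x y z x' y' z',
    (x, y, z') \in H -> (x, y', z) \in H -> (x', y, z) \in H ->
    [/\ x' = x, y' = y & z' = z].

Section Shadow.
Variables (U T C : finType) (H : {set U}) (px pz : U -> T) (c : T -> C).

Definition shadow (z : T) : {set T} := px @: [set h in H | pz h == z].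

Definition thin (m : nat) (h : U) : bool :=
  m * #|[set x in shadow (pz h) | c x == c (px h)]| < #|[set x | c x == c (px h)]|.

Lemma mem_shadow h : h \in H -> px h \in shadow (pz h).
Proof. by move=> hH; apply/imsetP; exists h; rewrite ?inE ?hH ?eqxx. Qed.

Hypothesis pxz_inj : {in H &, injective (fun h => (px h, pz h))}.

(** For fixed z, split the thin triples through z by the colour of [px h]. One thin triple in a
    class shows that the shadow of z fills less than 1/m of that class, and [px] is injective on
    triples through z. Summing over the classes gives [#|T|] for each z. *)
Lemma card_thin m : m * #|[set h in H | thin m h]| <= #|T| * #|T|.
Proof.
rewrite (card_fibers pz) big_distrr /= -sum_nat_const; apply: leq_sum => z _.
set B := [set h in _ | _].
have -> : #|B| = #|px @: B|.
  rewrite card_in_imset // => h k; rewrite !inE.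
  move=> /andP[/andP[hH _] /eqP hz] /andP[/andP[kH _] /eqP kz] e.
  by apply: pxz_inj; rewrite // e hz kz.
rewrite (card_fibers c) big_distrr /= -[X in _ <= X]cardsT (card_fibers c setT).
apply: leq_sum => a _.
have [->|[x]] := set_0Vmem [set x in px @: B | c x == a].
  by rewrite cards0 muln0.
rewrite !inE => /andP[/imsetP[h]]; rewrite !inE.
move=> /andP[/andP[hH th] /eqP hz] -> /eqP ha.
move: th; rewrite /thin hz ha => /ltnW th.
apply: leq_trans (leq_trans _ th) _.
  rewrite leq_mul2l; apply/orP; right; apply: subset_leq_card; apply/subsetP => y.
  rewrite !inE => /andP[/imsetP[k]]; rewrite !inE => /andP[/andP[kH _] /eqP kz] -> ->.
  by rewrite andbT -kz mem_shadow.
by apply: subset_leq_card; apply/subsetP => y; rewrite !inE.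
Qed.

End Shadow.

(* The relation R on colours describes a union W of cells of T * T, of size area;
   loss counts the triples with (x, y) outside W. From each cell (a, b) of W
   containing (x, y) for a good triple (x, y, z), refine cuts out the rectangle
   (a meet A_z) x (b meet B_z), where A_z and B_z are the shadows of the triples
   through z. By corner-freeness the triples lying over A_z x B_z all pass
   through z, so each cell costs at most #|T| triples, while the area drops by
   a fixed proportion of the area of that cell. *)
Section Step.
Variables (T C : finType) (H : {set T * T * T}) (c : T -> C) (R : {set C * C}).
Hypothesis cfH : corner_free H.

Definition px (h : T * T * T) := h.1.1.
Definition py (h : T * T * T) := h.1.2.
Definition pz (h : T * T * T) := h.2.

Definition cell (p : T * T) : C * C := (c p.1, c p.2).
Definition area := #|[set p | cell p \in R]|.
Definition loss := #|[set h in H | cell h.1 \notin R]|.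

Lemma corner_free_xy : {in H &, injective (fun h => h.1)}.
Proof.
by move=> [[x y] z] [[x' y'] z'] h h' /= [??]; subst; case: (cfH h' h h) => _ _ ->.
Qed.

Lemma corner_free_xz : {in H &, injective (fun h => (px h, pz h))}.
Proof.
move=> [[x y] z] [[x' y'] z'] h h'; rewrite /px /py /pz /= => -[??]; subst.
by case: (cfH h h' h) => _ ->.
Qed.

Lemma corner_free_yz : {in H &, injective (fun h => (py h, pz h))}.
Proof.
move=> [[x y] z] [[x' y'] z'] h h'; rewrite /px /py /pz /= => -[??]; subst.
by case: (cfH h h h') => ->.
Qed.

(** A triple (x, y, z0) over the rectangle forms a corner with some (x, y1, z) and (x2, y, z) in
    [H], so z0 = z; a triple through z is determined by x. *)
Lemma shadow_square z :
  #|[set h in H | (px h \in shadow H px pz z) && (py h \in shadow H py pz z)]| <= #|T|.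
Proof.
set B := [set h in _ | _].
have Bz h : h \in B -> pz h = z.
  rewrite !inE => /and3P[hH /imsetP[h1 + e1] /imsetP[h2 + e2]]; rewrite !inE.
  case: h h1 h2 hH e1 e2 => [[x y] z0] [[x1 y1] z1] [[x2 y2] z2]; rewrite /px /py /pz /=.
  move=> h ?? /andP[h1 /eqP ?] /andP[h2 /eqP ?]; subst.
  by case: (cfH h h1 h2).
have BH h : h \in B -> h \in H by rewrite inE => /andP[].
rewrite -(card_in_imset (f := px)) ?max_card // => h k hB kB e.
by apply: corner_free_xz; rewrite ?BH //= e !Bz.
Qed.

Variables (m : nat).

Definition good h := ~~ thin H px pz c (4 * m) h && ~~ thin H py pz c (4 * m) h.
(** The point z whose shadows are cut out of the cell [p]. A cell without good triples has no apex,
    and its cut is empty. *)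
Definition apex (p : C * C) : option T :=
  omap pz [pick h | [&& h \in H, cell h.1 == p & good h]].
Definition cut_x p : {set T} := if apex p is Some z then shadow H px pz z else set0.
Definition cut_y p : {set T} := if apex p is Some z then shadow H py pz z else set0.

(** Besides the old colour of v, the new one records the cells for which v lies in the first,
    respectively second, side of the cut rectangle. Every cut rectangle is thus a union of new
    cells. *)
Definition refine (v : T) : C * {set C * C} * {set C * C} :=
  (c v, [set p | v \in cut_x p], [set p | v \in cut_y p]).

Definition refine_rel : {set (C * {set C * C} * {set C * C}) * (C * {set C * C} * {set C * C})} :=
  [set q : (_ * {set _} * {set _}) * (_ * {set _} * {set _}) | let p := (q.1.1.1, q.2.1.1) in
     (p \in R) && ~~ ((p \in q.1.1.2) && (p \in q.2.2))].

Lemma refine_relE p :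
  ((refine p.1, refine p.2) \in refine_rel)
  = (cell p \in R) && ~~ ((p.1 \in cut_x (cell p)) && (p.2 \in cut_y (cell p))).
Proof. by rewrite !inE /= !inE. Qed.

Definition cut_rect := [set p | [&& cell p \in R, p.1 \in cut_x (cell p) & p.2 \in cut_y (cell p)]].

Lemma refine_area : #|[set p | (refine p.1, refine p.2) \in refine_rel]| + #|cut_rect| = area.
Proof.
rewrite /area -(cardsID cut_rect [set p | cell p \in R]) addnC; congr (_ + _); apply: eq_card => p.
  by rewrite !inE; do !case: (_ \in _).
by rewrite [LHS]in_set refine_relE !inE; do !case: (_ \in _).
Qed.

Lemma refine_loss :
  #|[set h in H | (refine h.1.1, refine h.1.2) \notin refine_rel]| <= loss + #|C| * #|C| * #|T|.
Proof.
pose K := [set h in H | (px h \in cut_x (cell h.1)) && (py h \in cut_y (cell h.1))].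
apply: (@leq_trans (loss + #|K|)).
  rewrite -cardsUI; apply: leq_trans (leq_addr _ _).
  apply: subset_leq_card; apply/subsetP => h.
  rewrite [X in is_true X -> _]in_set refine_relE !in_set /px /py.
  by case: (_ \in _) => //=; case: (_ \in _) => //=; rewrite negbK.
rewrite leq_add2l (card_fibers (fun h => cell h.1)) -card_prod -sum_nat_const.
apply: leq_sum => p _; case E : (apex p) => [z|]; last first.
  rewrite (_ : [set _ in _ | _] = set0) ?cards0 //; apply/setP => h; rewrite !inE.
  by case: eqP => [->|]; rewrite ?andbF // /cut_x E inE !andbF.
apply: leq_trans (shadow_square z); apply: subset_leq_card; apply/subsetP => h.
by rewrite !inE => /andP[+ /eqP ep]; rewrite ep /cut_x /cut_y E.
Qed.

(** In a cell A x B with a good triple, each side of the rectangle has relative density at least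
    1/(4m), as the apex comes from a good triple. The cell contains at most |A| |B| triples, since
    (x, y) determines z. *)
Lemma card_cut_rect :
  #|[set h in H | good h && (cell h.1 \in R)]| <= 16 * m ^ 2 * #|cut_rect|.
Proof.
set G := [set h in _ | _].
rewrite (card_fibers (fun h => cell h.1)) (card_fibers cell cut_rect) big_distrr.
apply: leq_sum => -[a b] _ /=.
have [->|[h0]] := set_0Vmem [set h in G | cell h.1 == (a, b)]; first by rewrite cards0.
rewrite 2!inE => /andP[/and3P[h0H g0 +] /eqP e0]; rewrite e0 => abR.
have [k [kH ek gk ez]] : exists k, [/\ k \in H, cell k.1 = (a, b), good k & apex (a, b) = Some (pz k)].
  rewrite /apex; case: pickP => [k /and3P[kH /eqP ek gk]|/(_ h0)]; first by exists k.
  by rewrite h0H e0 eqxx g0.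
pose A := [set x | c x == a]; pose B := [set x | c x == b].
pose A' := [set x in shadow H px pz (pz k) | c x == a].
pose B' := [set x in shadow H py pz (pz k) | c x == b].
have lA : #|A| <= 4 * m * #|A'|.
  case/andP: gk => + _; rewrite /thin -leqNgt.
  by rewrite /px; case: ek => -> _.
have lB : #|B| <= 4 * m * #|B'|.
  case/andP: gk => _; rewrite /thin -leqNgt.
  by rewrite /py; case: ek => _ ->.
have -> : [set p in cut_rect | cell p == (a, b)] = setX A' B'.
  apply/setP => -[x y]; rewrite !inE /=.
  case: (boolP (cell (x, y) == (a, b))) => [/eqP e|].
    by rewrite e abR /cut_x /cut_y ez /= andbT; case: e => -> ->; rewrite !eqxx !andbT.
  by rewrite andbF xpair_eqE /= negb_and => /orP[] /negPf ->; rewrite ?andbF.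
rewrite cardsX.
apply: (@leq_trans (#|A| * #|B|)); last by apply: leq_trans (leq_mul lA lB) _; lia.
rewrite -cardsX.
set G' := [set h in G | _].
rewrite -(card_in_imset (f := fun h => h.1) (D := mem G')); last first.
  have GH h : h \in G' -> h \in H.
    by rewrite 2!inE => /andP[/andP[]].
  move=> h k'. move=> /GH hH /GH kH'; exact: corner_free_xy.
apply: subset_leq_card; apply/subsetP => _ /imsetP[h + ->].
by rewrite inE xpair_eqE !inE => /andP[_].
Qed.

(** After multiplication by 4m, [H] has weight at least 4 n^2 with n = [#|T|], while the triples
    thin in x, those thin in y and the lost ones have weight at most n^2 each; this leaves n^2. *)
Lemma card_good L :
  #|T| * #|T| <= m * #|H| -> loss <= L * #|T| -> 4 * m * L <= #|T| ->
  #|T| * #|T| <= 4 * m * #|[set h in H | good h && (cell h.1 \in R)]|.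
Proof.
move=> dH lL nL.
have bx := card_thin c corner_free_xz (4 * m).
have by' := card_thin c corner_free_yz (4 * m).
set G := #|_| ; move: bx by'; set BX := [set h in H | _]; set BY := [set h in H | _].
move=> bx by'.
have cH : #|H| <= G + loss + #|BX| + #|BY|.
  have sub : H \subset [set h in H | good h && (cell h.1 \in R)]
      :|: [set h in H | cell h.1 \notin R] :|: BX :|: BY.
    apply/subsetP => h hH; rewrite !inE hH /= /good.
    by do !case: (thin _ _ _ _ _ _); rewrite ?orbT //=; case: (_ \in R).
  apply: leq_trans (subset_leq_card sub) _.
  by do 3!apply: leq_trans (leq_card_setU _ _) (leq_add _ (leqnn _)).
have : 4 * m * loss <= #|T| * #|T|.
  apply: leq_trans (leq_mul (leqnn _) lL) _.
  by rewrite mulnA leq_mul.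
have : 4 * m * #|H| <= 4 * m * (G + loss + #|BX| + #|BY|) by rewrite leq_mul2l cH orbT.
rewrite !mulnDr; move: dH bx by'; rewrite -!mulnA.
move: (#|T| * #|T|) => N; lia.
Qed.

End Step.

(** After j rounds the area has dropped by j n^2 / (64 m^3), where 64 m^3 is the product of 4m from
    [card_good] and 16 m^2 from [card_cut_rect]. The bounds depend on m and j only. *)
Lemma corner_free_iter (m j : nat) : exists K L N : nat, forall (T : finType) (H : {set T * T * T}),
  N <= #|T| -> corner_free H -> #|T| * #|T| <= m * #|H| ->
  exists (C : finType) (c : T -> C) (R : {set C * C}),
    [/\ #|C| <= K, loss H c R <= L * #|T| &
        64 * m ^ 3 * area c R + j * (#|T| * #|T|) <= 64 * m ^ 3 * (#|T| * #|T|)].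
Proof.
elim: j => [|j [K [L [N IH]]]].
  exists 1, 0, 0 => T H _ _ _; exists unit, (fun=> tt), setT; split.
  - by rewrite card_unit.
  - by rewrite /loss (_ : [set _ in _ | _] = set0) ?cards0 //; apply/setP => h; rewrite !inE andbF.
  by rewrite mul0n addn0 leq_mul2l /area -card_prod max_card orbT.
(* A new colour is an old colour with two sets of old cells; each of the at most K^2 cells loses at
   most [#|T|] triples; [card_good] asks for 4 m L <= [#|T|]. *)
exists (K * 2 ^ (K * K) * 2 ^ (K * K)), (L + K * K), (N + 4 * m * L) => T H nT cf dH.
have [|C [c [R [cK lL ar]]]] := IH T H _ cf dH; first by apply: leq_trans nT; rewrite leq_addr.
have nL : 4 * m * L <= #|T| by apply: leq_trans nT; rewrite leq_addl.
exists (C * {set C * C} * {set C * C})%type, (refine H c m), (refine_rel R); split.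
- rewrite !card_prod -!cardsT -!powersetT !card_powerset cardsT !cardsT card_prod.
  by rewrite !leq_mul // leq_exp2l // leq_mul.
- apply: leq_trans (refine_loss c R cf m) _; rewrite mulnDl leq_add //.
  by rewrite leq_mul2r leq_mul ?orbT.
have h1 := card_good cf dH lL nL.
have h2 := card_cut_rect c R cf m.
have h3 := refine_area H c R m.
move: ar; rewrite -h3 /area.
have : #|T| * #|T| <= 64 * m ^ 3 * #|cut_rect H c R m|.
  apply: leq_trans h1 _; apply: leq_trans (leq_mul (leqnn _) h2) _.
  by rewrite mulnA leq_mul2r; apply/orP; right; lia.
rewrite /cell mulnDr (mulSn j); move: (64 * m ^ 3) (#|T| * #|T|) => P n2 le_n2.
by apply: leq_trans; rewrite -addnA leq_add2l leq_add2r.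
Qed.

Lemma corner_free_card (m : nat) : exists N : nat, forall (T : finType) (H : {set T * T * T}),
  N <= #|T| -> corner_free H -> m * #|H| < #|T| * #|T|.
Proof.
(* The total area allows at most 64 m^3 rounds, so one more is contradictory once [#|T|] is
   positive, which [N.+1] ensures. *)
have [K [L [N it]]] := corner_free_iter m (64 * m ^ 3).+1.
exists N.+1 => T H nT cf; rewrite ltnNge; apply/negP => dH.
have [|C [c [R [_ _]]]] := it T H _ cf dH; first exact: ltnW.
have : 0 < #|T| * #|T| by rewrite muln_gt0 andbb; apply: leq_trans nT.
move: (#|T| * #|T|) (64 * m ^ 3 * area c R) => n2 a; rewrite (mulSn (64 * m ^ 3)); lia.
Qed.

(** * Counting small sets *)

(* Weight each set A by q ^ (#|T| - #|A|): the total weight is (q + 1) ^ #|T|. *)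
Lemma card_small_sets (T : finType) (q s : nat) : 0 < q ->
  #|[set A : {set T} | #|A| <= s]| * q ^ (#|T| - s) <= q.+1 ^ #|T|.
Proof.
move=> q0; rewrite -addn1 expnDn.
apply: (@leq_trans (\sum_(A : {set T}) q ^ (#|T| - #|A|))).
  rewrite -sum_nat_const big_mkcond /=; apply: leq_sum => A _.
  by case: ifP => //; rewrite inE => h; rewrite leq_pexp2l // leq_sub2l.
rewrite (partition_big (fun A : {set T} => inord #|A| : 'I_#|T|.+1) predT) //=.
apply: leq_sum => i _; rewrite exp1n muln1.
rewrite (eq_bigl (fun A => A \in [set A : {set T} | #|A| == i])); last first.
  by move=> A; rewrite inE -val_eqE /= inordK // ltnS max_card.
rewrite -card_draws -sum_nat_const.
by apply: leq_sum => A; rewrite inE => /eqP ->.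
Qed.

(** This is (1 + 1/q)^K (1 - K/q) <= 1 with denominators cleared; q = 2K yields (1 + 1/q)^K <= 2. *)
Lemma bernoulli_le (q K : nat) : K <= q -> (q - K) * q.+1 ^ K <= q * q ^ K.
Proof.
elim: K => [|K IH] Kq; first by rewrite subn0.
have {}IH := IH (ltnW Kq).
have h : (q - K.+1) * q.+1 <= (q - K) * q by nia.
rewrite !expnS mulnA; apply: leq_trans (leq_mul h (leqnn _)) _.
by rewrite mulnAC (mulnC q (q * _)) leq_mul2r IH orbT.
Qed.

(** With q = 2K, the K-th power of the weighted count is at most (1 + 1/q)^(K #|T|) q^(s K). Each
    factor is at most 2^#|T|, the second because q <= 2^q and q s K <= [#|T|]. *)
Lemma card_small_sets_subexp (T : finType) (K s : nat) : 0 < K ->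
  2 * K * K * s <= #|T| ->
  #|[set A : {set T} | #|A| <= s]| ^ K <= 4 ^ #|T|.
Proof.
move=> K0 sT; set B := #|_|; pose q := 2 * K.
have q0 : 0 < q by rewrite /q; lia.
have h1 : q.+1 ^ K <= 2 * q ^ K.
  have Kq : K <= q by rewrite /q; lia.
  have := bernoulli_le Kq; rewrite (_ : q - K = K); last by rewrite /q; lia.
  move=> h; rewrite -(leq_pmul2l K0); apply: leq_trans h _.
  by rewrite mulnA (mulnC K 2).
have sT' : s <= #|T| by apply: leq_trans sT; rewrite leq_pmull // !muln_gt0 K0.
have h2 := card_small_sets T s q0.
have h3 : (B * q ^ #|T|) ^ K <= (q.+1 ^ #|T| * q ^ s) ^ K.
  rewrite leq_exp2r // -[X in q ^ X](subnK sT') expnD mulnA leq_mul2r.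
  by rewrite h2 orbT.
have h4 : (q ^ s) ^ K <= 2 ^ #|T|.
  rewrite -expnM; apply: (@leq_trans ((2 ^ q) ^ (s * K))).
    have [->|p] := posnP (s * K); first by rewrite !expn0.
    by rewrite leq_exp2r // ltnW // ltn_expl.
  by rewrite -expnM leq_exp2l //; apply: leq_trans sT; rewrite /q; nia.
have h5 : (q.+1 ^ #|T|) ^ K <= 2 ^ #|T| * (q ^ #|T|) ^ K.
  rewrite -!expnM ![#|T| * K]mulnC !expnM -expnMn.
  by have [->|p] := posnP #|T|; rewrite ?expn0 // leq_exp2r.
have : B ^ K * (q ^ #|T|) ^ K <= 4 ^ #|T| * (q ^ #|T|) ^ K.
  rewrite -expnMn; apply: leq_trans h3 _; rewrite expnMn.
  apply: leq_trans (leq_mul h5 h4) _.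
  by rewrite mulnAC -expnMn.
by rewrite leq_pmul2r // !expn_gt0 q0.
Qed.

Lemma poly_le_exp (k : nat) : 0 < k -> exists N, forall n, N <= n -> n.+1 ^ k <= 2 ^ n.
Proof.
move=> k0; exists (4 * k * k) => n nN.
(* Then n + 1 <= 2k 2^t, and the k-th power costs 2^(2k^2) 2^(n/2) at most, each factor being at
   most 2^(n/2). *)
pose t := n %/ (2 * k).
have h1 : n.+1 <= 2 * k * 2 ^ t.
  apply: (@leq_trans (2 * k * t.+1)); last by rewrite leq_mul2l ltn_expl ?orbT.
  by rewrite mulnC; apply: ltn_ceil; lia.
apply: (@leq_trans ((2 * k * 2 ^ t) ^ k)); first by rewrite leq_exp2r.
have h2 : t * (2 * k) <= n by apply: leq_divM.
have h3 : (2 * k) ^ k <= 2 ^ (2 * k * k).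
  by rewrite expnM leq_exp2r // ltnW // ltn_expl.
rewrite expnMn -expnM; apply: leq_trans (leq_mul h3 (leqnn _)) _.
by rewrite -expnD leq_exp2l //; nia.
Qed.

(** * Triangle-free spaces of lines *)

(** Collinearity of distinct points in a linear space. By [col_triangle], three points joined
    pairwise by long lines lie on one line. *)
Record triangle_free_space (T : finType) (col : T -> T -> T -> bool) : Prop := {
  col_swap12 : forall x y z, col x y z -> col y x z;
  col_swap23 : forall x y z, col x y z -> col x z y;
  col_neq : forall x y z, col x y z -> x != y;
  col_trans : forall x y z w, z != w -> col x y z -> col x y w -> col x z w;
  col_triangle : forall x y z a b c, col x y a -> col y z b -> col x z c -> col x y z }.

Lemma next_distinct (T : eqType) (s : seq T) x : uniq s -> x \in s -> 2 < size s ->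
  [/\ x != next s x, next s x != next s (next s x) & x != next s (next s x)].
Proof.
move=> us /rot_to[i s' e] sz.
have: uniq (x :: s') by rewrite -e rot_uniq.
have: 2 < size (x :: s') by rewrite -e size_rot.
rewrite -!(next_rot i us) e; case: s' {e} => [|y [|z s']] //= _.
rewrite !eqxx !inE !negb_or => /and3P[/and3P[xy xz _] /andP[yz _] _].
by rewrite [y == x]eq_sym (negPf xy) yz (negPf xz).
Qed.

Section Space.
Variables (T : finType) (col : T -> T -> T -> bool).
Hypothesis sp : triangle_free_space col.

Definition line x y : {set T} := [set z | [|| z == x, z == y | col x y z]].

Lemma line_sym x y : line x y = line y x.
Proof.
apply/setP => z; rewrite !inE orbCA; do 2!congr (_ || _).
by apply/idP/idP => /(col_swap12 sp).
Qed.

Lemma mem_line_l x y : x \in line x y. Proof. by rewrite inE eqxx. Qed.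
Lemma mem_line_r x y : y \in line x y. Proof. by rewrite inE eqxx orbT. Qed.

Lemma line_sub x y b : b != x -> b \in line x y -> line x b \subset line x y.
Proof.
rewrite inE => /negPf ->/= /orP[/eqP->//|xyb]; apply/subsetP => z; rewrite !inE.
case/or3P => [->//|/eqP->|xbz]; first by rewrite xyb !orbT.
have [->|zy] := eqVneq z y; first by rewrite orbT.
by rewrite (col_trans sp _ (col_swap23 sp xyb) xbz) ?orbT // eq_sym.
Qed.

Lemma line_eq_l x y b : x != y -> b != x -> b \in line x y -> line x b = line x y.
Proof.
move=> xy bx bl; apply/eqP; rewrite eqEsubset line_sub //= line_sub 1?eq_sym //.
move: bl; rewrite !inE (negPf bx) /= => /orP[/eqP->|/(col_swap23 sp) ->]; last by rewrite !orbT.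
by rewrite eqxx orbT.
Qed.

Lemma line_eq x y a b : x != y -> a != b -> a \in line x y -> b \in line x y ->
  line a b = line x y.
Proof.
move=> xy; have [->|ax] := eqVneq a x.
  by move=> ab _ bl; apply: line_eq_l; rewrite // eq_sym.
move=> ab al; rewrite -(line_eq_l xy ax al) (line_sym x a) => bl.
by apply: line_eq_l; rewrite // eq_sym.
Qed.

Lemma col_in_line u v x y z : u != v -> x \in line u v -> y \in line u v -> z \in line u v ->
  x != y -> y != z -> x != z -> col x y z.
Proof.
move=> uv xl yl zl xy yz xz; move: zl; rewrite -(line_eq uv xy xl yl) inE.
by rewrite ![z == _]eq_sym (negPf xz) (negPf yz).
Qed.

Lemma col_neq23 x y z : col x y z -> y != z.
Proof. by move/(col_swap12 sp)/(col_swap23 sp)/(col_neq sp). Qed.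

Lemma col_neq13 x y z : col x y z -> x != z.
Proof. by move/(col_swap23 sp)/(col_neq sp). Qed.

Lemma line_col12 x y z : col x y z -> z \in line x y.
Proof. by rewrite inE => ->; rewrite !orbT. Qed.

Lemma line_col13 x y z : col x y z -> line x z = line x y.
Proof.
move=> h.
exact: line_eq (col_neq sp h) (col_neq13 h) (mem_line_l _ _) (line_col12 h).
Qed.

Lemma line_col23 x y z : col x y z -> line y z = line x y.
Proof.
move=> h.
exact: line_eq (col_neq sp h) (col_neq23 h) (mem_line_r _ _) (line_col12 h).
Qed.

Lemma line_gt2 x y z : col x y z -> 2 < #|line x y|.
Proof.
move=> h; have <- : #|[set x; y; z]| = 3.
  by rewrite -setUA cardsU1 cards2 !inE negb_or (col_neq sp h) (col_neq13 h) (col_neq23 h).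
apply: subset_leq_card; rewrite !subUset !sub1set.
by rewrite mem_line_l mem_line_r line_col12.
Qed.

Definition succ_in (L : {set T}) : T -> T := next (enum L).

Lemma succ_in_inj L : injective (succ_in L).
Proof. by apply: can_inj (prev_next _); apply: enum_uniq. Qed.

Lemma succ_in_mem (L : {set T}) x : x \in L -> succ_in L x \in L.
Proof. by rewrite -mem_enum -(mem_next (enum L)) mem_enum. Qed.

Lemma succ_in_distinct (L : {set T}) x : x \in L -> 2 < #|L| ->
  [/\ x != succ_in L x, succ_in L x != succ_in L (succ_in L x) & x != succ_in L (succ_in L x)].
Proof. by rewrite -mem_enum cardE => xL sz; apply: next_distinct; rewrite ?enum_uniq. Qed.

(* One triple starts at each point of each line, so that the number of triples is
   the total length of the lines. *)
Definition cyc_triples : {set T * T * T} :=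
  [set h | let L := line h.1.1 h.1.2 in
     [&& col h.1.1 h.1.2 h.2, h.1.2 == succ_in L h.1.1 & h.2 == succ_in L h.1.2]].

Lemma corner_free_cyc_triples : corner_free cyc_triples.
Proof.
move=> x y z x' y' z'; rewrite !inE /= => /and3P[c1 /eqP e1 /eqP f1].
move=> /and3P[c2 /eqP e2 /eqP f2] /and3P[c3 /eqP e3 /eqP f3].
have cxz := col_swap23 sp c2.
have cyz : col y z x' by apply: (col_swap23 sp); apply: (col_swap12 sp).
(* The three pairs lie on long lines, so all three triples lie on a single line, where injectivity
   of the successor forces them to coincide. *)
have c := col_triangle sp c1 cyz cxz.
have l2 : line x y' = line x y by rewrite -(line_col13 c2) (line_col13 c).
have l3 : line x' y = line x y by rewrite -(line_col23 c3) (line_col23 c).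
rewrite l2 in e2 f2; rewrite l3 in e3 f3.
have ey : y' = y by rewrite e2 -e1.
split=> //; last by rewrite f1 -f3.
by apply: (@succ_in_inj (line x y)); rewrite -e3 -e1.
Qed.

(** The choice depends on the set [L] alone, so all pairs spanning a line get the same base. *)
Definition base (L : {set T}) : option (T * T) :=
  [pick p | [&& p.1 \in L, p.2 \in L & p.1 != p.2]].

Definition based_triples : {set T * T * T} :=
  [set h | col h.1.1 h.1.2 h.2 && (base (line h.1.1 h.1.2) == Some h.1)].

(** Send (u, v, w) to the cyclic triple starting at w on the same line. Its first two points recover
    the line, hence the base (u, v), and the first is w. *)
Lemma card_based_triples : #|based_triples| <= #|cyc_triples|.
Proof.
pose s (h : T * T * T) := succ_in (line h.1.1 h.1.2).
pose phi h := (h.2, s h h.2, s h (s h h.2)).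
have lineE h : h \in based_triples ->
    line h.2 (s h h.2) = line h.1.1 h.1.2 /\ col h.2 (s h h.2) (s h (s h h.2)).
  rewrite inE => /andP[c _]; have uv := col_neq sp c.
  have wl := line_col12 c; have [d1 d2 d3] := succ_in_distinct wl (line_gt2 c).
  have sl := succ_in_mem wl.
  by split; [apply: line_eq | apply: col_in_line uv _ _ _ _ _ _; rewrite ?succ_in_mem].
rewrite -(card_in_imset (f := phi)).
  apply: subset_leq_card; apply/subsetP => _ /imsetP[h hQ ->].
  by have [e c] := lineE h hQ; rewrite inE /= c e /s !eqxx.
move=> h k hQ kQ [e1 e2 _]; have [eh _] := lineE h hQ; have [ek _] := lineE k kQ.
have: line h.1.1 h.1.2 = line k.1.1 k.1.2 by rewrite -eh -ek e2 e1.
move: hQ kQ; rewrite !inE => /andP[_ /eqP bh] /andP[_ /eqP bk] el.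
move: bh; rewrite el bk => -[ep]; move: e1 ep.
by case: h {el eh e2} => hp hw; case: k {bk ek} => kp kw /= -> ->.
Qed.

(** The three projections place the pairs of u, v, w on long lines, so the points are collinear by
    triangle-freeness; the base condition involves only (u, v). *)
Lemma based_triplesE u v w :
  ((u, v, w) \in based_triples) =
  [&& (u, v) \in [set h.1 | h in based_triples],
      (u, w) \in [set (h.1.1, h.2) | h in based_triples] &
      (v, w) \in [set (h.1.2, h.2) | h in based_triples]].
Proof.
apply/idP/and3P => [h|[]].
  by split; apply/imsetP; exists (u, v, w).
move=> /imsetP[[[u1 v1] w1] + /= [??]] /imsetP[[[u2 v2] w2] + /= [??]].
move=> + + /imsetP[[[u3 v3] w3] + /= [??]]; subst; rewrite !inE /=.
move=> /andP[c1 b] /andP[c2 _] /andP[c3 _]; rewrite b andbT.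
apply: (col_triangle sp c1 _ (col_swap23 sp c2)).
by apply: (col_swap23 sp); apply: (col_swap12 sp); exact: c3.
Qed.

Definition block (Q : {set T * T * T}) (p : T * T) : {set T} :=
  [set w | [|| w == p.1, w == p.2 | (p, w) \in Q]].

Lemma col_based_triples x y z :
  col x y z = [&& x != y, y != z, x != z &
    [exists h in based_triples,
      [&& x \in block based_triples h.1, y \in block based_triples h.1 &
          z \in block based_triples h.1]]].
Proof.
apply/idP/and4P => [c|[xy yz xz /exists_inP[[[u v] w] hQ /and3P[xb yb zb]]]].
  have [xy yz xz] := And3 (col_neq sp c) (col_neq23 c) (col_neq13 c).
  split=> //.
  have [[u v] eb /and3P[/= ul vl uv]] : exists2 p, base (line x y) = Some p &
     [&& p.1 \in line x y, p.2 \in line x y & p.1 != p.2].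
    rewrite /base; case: pickP => [p hp|/(_ (x, y))]; first by exists p.
    by rewrite mem_line_l mem_line_r xy.
  have el := line_eq xy uv ul vl.
  have bl t : t \in line x y -> t \in block based_triples (u, v).
    by rewrite -el !inE el eb eqxx andbT.
  have [xl yl zl] := And3 (mem_line_l x y) (mem_line_r x y) (line_col12 c).
  (* One of three distinct points differs from both base points, so some based triple exists over
     (u, v). *)
  have [w wl /andP[wu wv]] : exists2 w, w \in line x y & (w != u) && (w != v).
    have [xu|xu] := boolP ((x != u) && (x != v)); first by exists x.
    have [yu|yu] := boolP ((y != u) && (y != v)); first by exists y.
    exists z => //; move: xu yu xy yz xz; rewrite !negb_and !negbK.
    by move=> /orP[] /eqP -> /orP[] /eqP ->; rewrite ?eqxx // ![_ == z]eq_sym => _ -> ->.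
  apply/exists_inP; exists (u, v, w); last by rewrite !bl.
  move: (bl w wl); rewrite [in X in X -> _]inE /= (negPf wu) (negPf wv) /=.
  by rewrite !inE.
have [uv bl] : u != v /\ forall t, t \in block based_triples (u, v) -> t \in line u v.
  move: hQ; rewrite inE => /andP[/= /(col_neq sp) uv _]; split=> // t.
  by rewrite !inE => /or3P[->|->|/andP[/= -> _]]; rewrite ?orbT.
by apply: col_in_line uv _ _ _ _ _ _; rewrite ?bl.
Qed.

End Space.

(** * Rank-3 matroids *)

Lemma cards3P (T : finType) (A : {set T}) : #|A| = 3 ->
  exists x y z, [/\ A = [set x; y; z], x != y, y != z & x != z].
Proof.
move=> cA; have /card_gt0P[x xA] : 0 < #|A| by rewrite cA.
have /cards2P[y [z [yz e]]] : #|A :\ x| == 2.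
  by have := cardsD1 x A; rewrite cA xA => -[]; rewrite add0n => <-.
exists x, y, z; rewrite -setUA -e setD1K //; split=> //.
  by have := in_setD1 y A x; rewrite e !inE eqxx /= eq_sym; case: eqP.
by have := in_setD1 z A x; rewrite e !inE eqxx orbT /= eq_sym; case: eqP.
Qed.

Lemma card_lt3_sub (T : finType) (x0 : T) (A : {set T}) : #|A| < 3 ->
  exists x y, A \subset [set x; y].
Proof.
move=> cA; have [->|[x xA]] := set_0Vmem A; first by exists x0, x0; rewrite sub0set.
have := cardsD1 x A; rewrite xA => cD.
have [e0|[y yA]] := set_0Vmem (A :\ x).
  by exists x, x; rewrite setUid -(setD1K xA) e0 setU0.
exists x, y; rewrite -(setD1K xA) setUS //.
have := cardsD1 y (A :\ x); rewrite yA => cD2.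
rewrite -(setD1K yA) (_ : (A :\ x) :\ y = set0) ?setU0 //.
by apply/eqP; rewrite -cards_eq0; lia.
Qed.

Section Matroid.
Variables (T : finType) (F : {set {set T}}).
Hypothesis matF : is_matroid F.

Lemma indep_sub (I J : {set T}) : I \in F -> J \subset I -> J \in F.
Proof.
case/and3P: matF => _ /forall_inP h _ IF JI.
by have /forallP/(_ J)/implyP := h I IF; apply.
Qed.

Lemma indep_augment (I J : {set T}) : I \in F -> J \in F -> #|I| < #|J| ->
  exists2 x, x \in J :\: I & x |: I \in F.
Proof.
case/and3P: matF => _ _ /forall_inP h IF JF lt.
by have /forall_inP/(_ J JF) := h I IF; rewrite lt /= => /exists_inP.
Qed.

Definition par x y := [&& [set x] \in F, [set y] \in F & (x == y) || ([set x; y] \notin F)].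

Lemma par_sym x y : par x y = par y x.
Proof. by rewrite /par eq_sym setUC andbCA. Qed.

Lemma par_trans x y z : par x y -> par y z -> par x z.
Proof.
move=> /and3P[x1 y1 xy] /and3P[_ z1 yz]; rewrite /par x1 z1 /=.
have [//|nxz] := eqVneq x z; apply/negP => xz.
have [|t] := indep_augment y1 xz; first by rewrite cards1 cards2 nxz.
rewrite !inE => /andP[ty /orP[] /eqP e]; subst t.
  by move: xy; rewrite (negPf ty) /= => /negPf ->.
by move: yz; rewrite eq_sym (negPf ty) setUC /= => /negPf ->.
Qed.

(** [None] marks loops; otherwise the pick depends only on the parallel class. The fixed points form
    the simplification. *)
Definition rep x : option T := if [set x] \in F then [pick y | par x y] else None.

Lemma par_rep x y : par x y -> rep x = rep y.
Proof.
move=> xy; rewrite /rep; case/and3P: (xy) => -> -> _; apply: eq_pick => z /=.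
by apply/idP/idP => h; apply: par_trans h; rewrite 1?par_sym // par_sym.
Qed.

Lemma rep_par x a : rep x = Some a -> par x a.
Proof. by rewrite /rep; case: ifP => // _; case: pickP => // y h [<-]. Qed.

Lemma rep_some x : ([set x] \in F) = (rep x != None).
Proof.
rewrite /rep; case: ifP => // h; case: pickP => // /(_ x).
by rewrite /par h eqxx.
Qed.

Definition reps : {set T} := [set x | rep x == Some x].

Lemma rep_reps x a : rep x = Some a -> a \in reps.
Proof. by move=> e; rewrite inE -(par_rep (rep_par e)) e. Qed.

Lemma reps_indep x y : x \in reps -> y \in reps -> [set x; y] \in F.
Proof.
rewrite !inE => /eqP ex /eqP ey.
have x1 : [set x] \in F by rewrite rep_some ex.
have y1 : [set y] \in F by rewrite rep_some ey.
apply/idPn => xy; have /par_rep : par x y by rewrite /par x1 y1 xy orbT.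
by rewrite ex ey => -[e]; move: xy; rewrite e setUid y1.
Qed.

Definition collinear x y z :=
  [&& x \in reps, y \in reps, z \in reps, x != y, y != z, x != z & [set x; y; z] \notin F].

Definition ind3 x y z := [&& x != y, y != z, x != z & [set x; y; z] \in F].

Lemma ind3_swap12 x y z : ind3 x y z = ind3 y x z.
Proof. by rewrite /ind3 (setUC [set x] [set y]) [x == y]eq_sym; do !case: (_ == _). Qed.

Lemma ind3_swap23 x y z : ind3 x y z = ind3 x z y.
Proof. by rewrite /ind3 setUAC [y == z]eq_sym; do !case: (_ == _). Qed.

Lemma ind3_npar x y z : ind3 x y z -> ~~ par x y.
Proof.
case/and4P => xy _ _ F3; have F2 : [set x; y] \in F by apply: indep_sub F3 _; apply: subsetUl.
by rewrite /par (negPf xy) F2 /= andbF andbF.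
Qed.

(** Augment {x'} twice from {x, y, z}: unless x = x', the added points cannot be x, so they are y
    and z. *)
Lemma par_ind3 x x' y z : par x x' -> ind3 x y z -> ind3 x' y z.
Proof.
move=> pxx' i3; have /and4P[xy yz xz xyz] := i3.
case/and3P: (pxx') => x1 x'1 /orP[/eqP <- //|nxx'].
have x'y : x' != y by apply: contraNneq (ind3_npar i3) => <-.
have x'z : x' != z by move: i3; rewrite ind3_swap23 => /ind3_npar; apply: contraNneq => <-.
rewrite /ind3 x'y yz x'z /=.
have nx (A : {set T}) : x \in A -> x' \in A -> A \notin F.
  move=> xA x'A; apply: contra nxx' => AF; apply: indep_sub AF _.
  by rewrite subUset !sub1set xA.
have c3 : #|[set x; y; z]| = 3 by rewrite -setUA cardsU1 cards2 !inE negb_or xy xz yz.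
have [|t] := indep_augment x'1 xyz; first by rewrite cards1 c3.
rewrite !inE => /andP[tx' tt] tF.
have tx : t != x by apply: contraTneq tF => ->; apply: nx; rewrite !inE eqxx ?orbT.
have [|u] := indep_augment tF xyz; first by rewrite cards2 c3 tx'.
rewrite !inE negb_or => /andP[/andP[ut ux'] uu] uF.
have ux : u != x by apply: contraTneq uF => ->; apply: nx; rewrite !inE eqxx ?orbT.
apply: indep_sub uF _; move: tt uu ut; rewrite (negPf tx) (negPf ux) /=.
by move=> /orP[] /eqP -> /orP[] /eqP ->; rewrite ?eqxx // => _;
  apply/subsetP => v; rewrite !inE => /orP[/orP[]|] ->; rewrite ?orbT.
Qed.

Lemma ind3_rep x y z a b c : rep x = Some a -> rep y = Some b -> rep z = Some c ->
  ind3 x y z = ind3 a b c.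
Proof.
have half x1 y1 z1 x2 y2 z2 : par x1 x2 -> par y1 y2 -> par z1 z2 ->
    ind3 x1 y1 z1 -> ind3 x2 y2 z2.
  move=> px py pz /(par_ind3 px); rewrite ind3_swap12 => /(par_ind3 py).
  rewrite ind3_swap23 ind3_swap12 => /(par_ind3 pz).
  by rewrite ind3_swap12 ind3_swap23 ind3_swap12.
move=> /rep_par pa /rep_par pb /rep_par pc; apply/idP/idP; apply: half => //;
  by rewrite par_sym.
Qed.

Lemma indep3E x y z : x != y -> y != z -> x != z ->
  ([set x; y; z] \in F) =
  if (rep x, rep y, rep z) is (Some a, Some b, Some c)
  then [&& a != b, b != c, a != c & ~~ collinear a b c] else false.
Proof.
move=> xy yz xz; have -> : ([set x; y; z] \in F) = ind3 x y z by rewrite /ind3 xy yz xz.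
have loop t : rep t = None -> t \in [set x; y; z] -> ind3 x y z = false.
  move=> e tS; apply/negP => /and4P[_ _ _ F3].
  have: [set t] \in F by apply: indep_sub F3 _; rewrite sub1set.
  by rewrite rep_some e.
case ex : (rep x) => [a|]; last by apply: loop ex _; rewrite !inE eqxx.
case ey : (rep y) => [b|]; last by apply: loop ey _; rewrite !inE eqxx orbT.
case ez : (rep z) => [c|]; last by apply: loop ez _; rewrite !inE eqxx orbT.
rewrite (ind3_rep ex ey ez) /ind3 /collinear (rep_reps ex) (rep_reps ey) (rep_reps ez).
by do !case: (_ == _) => //=; rewrite negbK.
Qed.

Hypothesis rk3 : rk F setT = 3.

Lemma indep_le3 I : I \in F -> #|I| <= 3.
Proof. by move=> IF; rewrite -rk3 /rk; apply: leq_bigmax_cond; rewrite IF subsetT. Qed.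

Lemma indep_extend I : I \in F -> exists J : {set T}, [/\ J \in F, #|J| = 3 & I \subset J].
Proof.
have [B BF cB] : exists2 B : {set T}, B \in F & #|B| = 3.
  have /(eq_bigmax_cond (fun I : {set T} => #|I|)) [B] : 0 < #|[pred I in F | I \subset setT]|.
    apply/card_gt0P; exists set0; rewrite inE subsetT andbT.
    by case/and3P: matF.
  by rewrite inE => /andP[BF _] e; exists B => //; rewrite -e -rk3.
move=> IF; move: {2}(3 - #|I|) (erefl (3 - #|I|)) => d.
elim: d I IF => [|d IH] I IF e.
  by exists I; split => //; apply/eqP; rewrite eqn_leq indep_le3 //= -subn_eq0 e.
have [|x /setDP[_ xI] xF] := indep_augment IF BF; first by rewrite cB -subn_gt0 e.
have [|J [JF cJ sJ]] := IH _ xF; first by rewrite cardsU1 xI subnDA subSn ?e //; lia.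
by exists J; split=> //; apply: subset_trans sJ; apply: subsetUr.
Qed.

Lemma indepE I : (I \in F) = [exists J : {set T}, [&& I \subset J, #|J| == 3 & J \in F]].
Proof.
apply/idP/existsP => [/indep_extend[J [JF cJ IJ]]|[J /and3P[IJ _ JF]]].
  by exists J; rewrite IJ cJ JF eqxx.
exact: indep_sub JF IJ.
Qed.

End Matroid.

(** Independent sets are the subsets of bases, and by [indep3E] a three-set is a basis according to
    its representatives and their collinearity. *)
Lemma matroid_ext (T : finType) (F1 F2 : {set {set T}}) :
  is_matroid F1 -> rk F1 setT = 3 -> is_matroid F2 -> rk F2 setT = 3 ->
  rep F1 =1 rep F2 -> (forall x y z, collinear F1 x y z = collinear F2 x y z) -> F1 = F2.
Proof.
move=> m1 r1 m2 r2 er ec; apply/setP => I; rewrite (indepE m1 r1) (indepE m2 r2).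
apply: eq_existsb => J; case: eqP => [|_]; rewrite ?andbF //= => cJ; congr (_ && _).
have [x [y [z [-> xy yz xz]]]] := cards3P cJ.
rewrite !indep3E // !er; case: (rep F2 x) => // a; case: (rep F2 y) => // b.
by case: (rep F2 z) => // c; rewrite ec.
Qed.

(** * Triangles of lines and excluded minors *)

Lemma has_minor6_restrict (T : finType) (F : {set {set T}}) (N : {set {set 'I_6}}) (f : 'I_6 -> T) :
  injective f -> (forall I : {set 'I_6}, (f @: I \in F) = (I \in N)) -> has_minor6 F N.
Proof.
move=> f_inj fN; apply/existsP; exists set0; apply/existsP; exists (finfun f).
have ff (X : {set 'I_6}) : finfun f @: X = f @: X by apply: eq_imset => i; rewrite ffunE.
apply/and3P; split; first by apply/injectiveP => i j; rewrite !ffunE; apply: f_inj.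
  by rewrite disjoints_subset setC0 subsetT.
apply/forallP => X; rewrite ff setU0.
have -> : rk F set0 = 0.
  apply/eqP; rewrite -leqn0 /rk; apply/bigmax_leqP => I /andP[_].
  by rewrite subset0 => /eqP->; rewrite cards0.
rewrite addn0 eqn_leq; apply/andP; split; apply/bigmax_leqP => I /andP[IF IX]; last first.
  by rewrite -(card_imset I f_inj); apply: leq_bigmax_cond; rewrite fN IF imsetS.
have e : f @: (f @^-1: I) = I.
  apply/setP => x; apply/imsetP/idP => [[i + ->]|xI]; first by rewrite inE.
  by have /imsetP[i _ ei] := subsetP IX x xI; exists i; rewrite // inE -ei.
rewrite -e card_imset //; apply: leq_bigmax_cond; rewrite -fN e IF /=.
by apply/subsetP => i; rewrite inE => /(subsetP IX)/imsetP[j jX /f_inj ->].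
Qed.

Lemma trip_eq i j k i' j' k' : i < j < k -> i' < j' < k' -> k < 6 -> k' < 6 ->
  (trip i j k == trip i' j' k') = [&& i == i', j == j' & k == k'].
Proof.
move=> /andP[ij jk] /andP[ij' jk'] k6 k6'.
have [i6 j6 i6' j6'] : [/\ i < 6, j < 6, i' < 6 & j' < 6] by split; lia.
have oE a b : a < 6 -> b < 6 -> (oI6 a == oI6 b) = (a == b).
  by move=> a6 b6; rewrite /oI6 -val_eqE /= !inordK.
apply/eqP/and3P => [e|[/eqP-> /eqP-> /eqP->] //].
have mem t : t < 6 -> (t \in [:: i; j; k]) = (t \in [:: i'; j'; k']).
  move=> t6; have := congr1 (fun A : {set 'I_6} => oI6 t \in A) e.
  by rewrite /trip !inE !oE // !orbA.
have := mem _ i6; have := mem _ j6; have := mem _ k6; have := mem _ i6'; have := mem _ j6'.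
have := mem _ k6'.
rewrite !inE !eqxx !orbT => *.
by suff [-> [-> ->]] : i = i' /\ j = j' /\ k = k' by []; lia.
Qed.

Lemma trip_of_card3 (I : {set 'I_6}) : #|I| = 3 ->
  exists i j k, [/\ i < j < k, k < 6 & I = trip i j k].
Proof.
move=> /cards3P[x [y [z [-> xy yz xz]]]].
have H (a b c : 'I_6) : a < b -> b < c -> [set x; y; z] = [set a; b; c] ->
    exists i j k, [/\ i < j < k, k < 6 & [set x; y; z] = trip i j k].
  move=> ab bc ->; exists a, b, c; rewrite ab bc ltn_ord; split=> //.
  by rewrite /trip /oI6 !inord_val.
case: (ltngtP x y) (xy) => [h1|h1|/val_inj ->]; last by rewrite eqxx.
  all: case: (ltngtP y z) (yz) => [h2|h2|/val_inj ->]; last by rewrite eqxx.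
  all: case: (ltngtP x z) (xz) => [h3|h3|/val_inj ->]; last by rewrite eqxx.
all: try lia.
all: move=> _ _ _.
all: first [by apply: (H x y z)
  | by apply: (H x z y) => //; rewrite setUAC
  | by apply: (H y x z) => //; rewrite (setUC [set x])
  | by apply: (H y z x) => //; rewrite -setUA setUC
  | by apply: (H z x y) => //; rewrite setUC setUA
  | by apply: (H z y x) => //; rewrite -setUA setUC (setUC [set y])].
Qed.

Lemma card_trip i j k : i < j < k -> k < 6 -> #|trip i j k| = 3.
Proof.
move=> /andP[ij jk] k6; rewrite /trip -setUA cardsU1 cards2 !inE /oI6 -!val_eqE /= !inordK; lia.
Qed.

Section Triangle.
Variables (T : finType) (F : {set {set T}}).
Hypotheses (matF : is_matroid F) (rk3 : rk F setT = 3).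
Local Notation col := (collinear F).

Lemma col_C12 x y z : col x y z = col y x z.
Proof.
rewrite /collinear (setUC [set x] [set y]) [x == y]eq_sym.
by do !case: (_ \in _) => //=; do !case: (_ == _).
Qed.

Lemma col_C23 x y z : col x y z = col x z y.
Proof.
rewrite /collinear setUAC [y == z]eq_sym.
by do !case: (_ \in _) => //=; do !case: (_ == _).
Qed.

Lemma col_distinct x y z : col x y z -> [/\ x != y, y != z & x != z].
Proof. by case/and5P => _ _ _ ? /and3P[]. Qed.

Lemma col_reps x y z : col x y z -> [/\ x \in reps F, y \in reps F & z \in reps F].
Proof. by case/and4P. Qed.

(** If {x, z, w} were independent, augmenting {x, y} from it would make {x, y, z} or {x, y, w}
    independent. *)
Lemma col_exchange x y z w : z != w -> col x y z -> col x y w -> col x z w.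
Proof.
move=> zw c1 c2; have [rx ry rz] := col_reps c1; have [_ _ rw] := col_reps c2.
have [xy yz xz] := col_distinct c1; have [_ yw xw] := col_distinct c2.
rewrite /collinear rx rz rw xz zw xw /=; apply/negP => F3.
have c3 : #|[set x; z; w]| = 3 by rewrite -setUA cardsU1 cards2 !inE negb_or xz xw zw.
have [|t] := indep_augment matF (reps_indep matF rx ry) F3; first by rewrite cards2 xy c3.
rewrite !inE negb_or => /andP[/andP[tx ty]]; rewrite (negPf tx) /= setUC => /orP[] /eqP -> tF.
  by move: c1; rewrite /collinear tF !andbF.
by move: c2; rewrite /collinear tF !andbF.
Qed.

Ltac colperm := by first [assumption | rewrite col_C12; assumption | rewrite col_C23; assumption
  | rewrite col_C12 col_C23; assumption | rewrite col_C23 col_C12; assumption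
  | rewrite col_C12 col_C23 col_C12; assumption].

Lemma opposite_corner a c d e : a != e -> col c d e -> ~~ col a c e -> d != a /\ ~~ col a c d.
Proof.
move=> ae cde nace; split; first by apply: contraNneq nace => <-; colperm.
apply: contra nace => acd; rewrite col_C12; apply: (col_exchange (y := d)) => //; colperm.
Qed.

Lemma two_midpoints a b c d e : a != e -> col a b c -> col c d e -> ~~ col a c e ->
  [/\ b != d, ~~ col a b d, ~~ col b c d & ~~ col b d e].
Proof.
move=> ae abc cde nace; have ea : e != a by rewrite eq_sym.
have [da nacd] := opposite_corner ae cde nace.
have [be ncbe] : b != e /\ ~~ col e c b.
  by apply: (opposite_corner (e := a)) => //; colperm.
have [ab bc ac] := col_distinct abc; have [cd de ce] := col_distinct cde.
split.
- apply: contraNneq nacd => bd; subst d; exfalso; move/negP: nace; apply.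
  rewrite col_C12; apply: (col_exchange (y := b)) => //; colperm.
- by apply: contra nacd => abd; apply: (col_exchange (y := b)).
- apply: contra nacd => bcd; rewrite col_C12; apply: (col_exchange (y := b));
  rewrite 1?eq_sym //; colperm.
- apply: contra ncbe => bde; apply: (col_exchange (y := d)); rewrite 1?eq_sym //; colperm.
Qed.

Hypotheses (noW3 : ~~ has_minor6 F W3) (noK4 : ~~ has_minor6 F MK4).

(** Otherwise a, c, e are the corners of a triangle with b, d, f on its sides. Of the 20 triples
    only the sides and possibly b, d, f are collinear, so the restriction to the six points is
    M(K_4) or W^3. *)
Lemma no_triangle a b c d e f : a != e -> col a b c -> col c d e -> col e f a -> col a c e.
Proof.
move=> ae abc cde efa; apply/idPn => nace.
have ea : e != a by rewrite eq_sym.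
have [ab bc ac] := col_distinct abc; have [cd de ce] := col_distinct cde.
have [ef fa _] := col_distinct efa.
have ca : c != a by rewrite eq_sym.
have ec : e != c by rewrite eq_sym.
have ncea : ~~ col c e a by colperm.
have neac : ~~ col e a c by colperm.
have [da nacd] := opposite_corner ae cde nace.
have [_ naed] : d != a /\ ~~ col a e d by apply: (opposite_corner (e := c)) => //; colperm.
have [fc ncef] := opposite_corner ca efa ncea.
have [_ ncaf] : f != c /\ ~~ col c a f by apply: (opposite_corner (e := e)) => //; colperm.
have [be neab] := opposite_corner ec abc neac.
have [_ necb] : b != e /\ ~~ col e c b by apply: (opposite_corner (e := a)) => //; colperm.
have [bd nabd nbcd nbde] := two_midpoints ae abc cde nace.
have [df ncdf ndef ndfa] := two_midpoints ca cde efa ncea.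
have [fb nefb nfab nfbc] := two_midpoints ec efa abc neac.
have [[ra rb rc] [_ rd re] [_ rf _]] := And3 (col_reps abc) (col_reps cde) (col_reps efa).
(* The default a keeps [p i] in [reps F] for every index i. *)
pose p := nth a [:: a; b; c; d; e; f].
have pr i : p i \in reps F by do 6!case: i => [//|i]; rewrite /p /= nth_nil.
have p_neq i j : i < j -> j < 6 -> p i != p j.
  case: j => [|[|[|[|[|[|j]]]]]] //; case: i => [|[|[|[|[|[|i]]]]]] //; move=> _ _; rewrite /p /= //;
  by rewrite eq_sym.
have colp i j k : i < j < k -> k < 6 -> col (p i) (p j) (p k) =
    ((i, j, k) \in [:: (0, 1, 2); (2, 3, 4); (0, 4, 5)]) || ((i, j, k) == (1, 3, 5)) && col b d f.
  move=> /andP[+ +]; case: k => [|[|[|[|[|[|k]]]]]] //;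
  case: j => [|[|[|[|[|[|j]]]]]] //; case: i => [|[|[|[|[|[|i]]]]]] //;
  move=> _ _ _; rewrite /p /=; first [by [] | colperm | apply/negbTE; colperm].
have indp i j k : i < j < k -> k < 6 -> ([set p i; p j; p k] \in F) = ~~ col (p i) (p j) (p k).
  move=> /andP[ij jk] k6.
  have [dij djk dik] : [/\ p i != p j, p j != p k & p i != p k].
    by split; apply: p_neq => //; [apply: ltn_trans jk k6 | apply: ltn_trans ij jk].
  by rewrite /collinear !pr dij djk dik negbK.
pose g (i : 'I_6) := p i.
have g_inj : injective g.
  move=> i j e1; apply/val_inj; case: (ltngtP i j) => // h.
    by have := p_neq i j h (ltn_ord j); rewrite -/(g i) e1 eqxx.
  by have := p_neq j i h (ltn_ord i); rewrite -/(g i) e1 eqxx.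
have small (I : {set 'I_6}) : #|I| < 3 -> g @: I \in F.
  move=> cI.
  have [i [j sub]] := card_lt3_sub ord0 cI.
  apply: (indep_sub matF (I := [set g i; g j])); first exact: (reps_indep matF (pr i) (pr j)).
  apply: subset_trans (imsetS g sub) _; rewrite imsetU !imset_set1; exact: subxx.
have trip450 : trip 4 5 0 = trip 0 4 5 by rewrite /trip setUC setUA.
have gtrip i j k : i < j < k -> k < 6 -> (g @: trip i j k \in F) = ~~ col (p i) (p j) (p k).
  move=> ijk k6; rewrite -indp // /trip !imsetU !imset_set1 /g /oI6.
  case/andP: ijk => ij jk; have j6 := ltn_trans jk k6.
  by rewrite !inordK // (ltn_trans ij).
have main (N : {set {set 'I_6}}) (s : seq (nat * nat * nat)) :
    (forall i j k, i < j < k -> k < 6 -> col (p i) (p j) (p k) = ((i, j, k) \in s)) ->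
    all (fun t => (t.1.1 < t.1.2 < t.2) && (t.2 < 6)) s ->
    N = [set I : {set 'I_6} | (#|I| <= 3) && (I \notin [seq trip t.1.1 t.1.2 t.2 | t <- s])] ->
    has_minor6 F N.
  move=> cs /allP sok ->; apply: (has_minor6_restrict g_inj) => I; rewrite inE.
  case: (ltngtP #|I| 3) => [lt|gt|cI].
  - rewrite small //; apply/esym/mapP => -[t /sok /andP[t1 t2] eI].
    by move: lt; rewrite eI card_trip.
  - by apply/negP => /(indep_le3 rk3); rewrite card_imset // leqNgt gt.
  have [i [j [k [ijk k6 ->]]]] := trip_of_card3 cI.
  rewrite gtrip // cs //=; congr (~~ _); apply/idP/mapP => [h|[[[i' j'] k'] h /eqP]].
    by exists (i, j, k).
  by have /andP[? ?] := sok _ h; rewrite trip_eq // => /and3P[/eqP-> /eqP-> /eqP->].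
have [bdf|nbdf] := boolP (col b d f).
  case/negP: noK4; apply: (main _ [:: (0, 1, 2); (2, 3, 4); (0, 4, 5); (1, 3, 5)]) => //.
    by move=> i j k ijk k6; rewrite colp // bdf andbT !inE -!orbA.
  by rewrite /MK4 /= trip450.
case/negP: noW3; apply: (main _ [:: (0, 1, 2); (2, 3, 4); (0, 4, 5)]) => //.
  by move=> i j k ijk k6; rewrite colp // (negPf nbdf) andbF orbF.
by rewrite /W3 /= trip450.
Qed.

Lemma col_triangle_free : triangle_free_space col.
Proof.
split=> [x y z|x y z|x y z /col_distinct[] //|x y z w|x y z a b c].
- by rewrite col_C12.
- by rewrite col_C23.
- exact: col_exchange.
move=> xya yzb xzc.
have [xz _ _] := col_distinct xzc.
apply: (@no_triangle x a y b z c) => //; colperm.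
Qed.

End Triangle.

(** * Counting *)

Definition code (T : finType) (F : {set {set T}}) :=
  let Q := based_triples (collinear F) in
  ([ffun x => rep F x],
   [set h.1 | h in Q], [set (h.1.1, h.2) | h in Q], [set (h.1.2, h.2) | h in Q]).

Definition excl (T : finType) : {set {set {set T}}} :=
  [set F | [&& is_matroid F, rk F setT == 3, ~~ has_minor6 F W3 & ~~ has_minor6 F MK4]].

Lemma code_inj (T : finType) : {in excl T &, injective (@code T)}.
Proof.
move=> F1 F2; rewrite !inE => /and4P[m1 /eqP r1 w1 k1] /and4P[m2 /eqP r2 w2 k2] [er e12 e13 e23].
have s1 := col_triangle_free m1 r1 w1 k1; have s2 := col_triangle_free m2 r2 w2 k2.
have eQ : based_triples (collinear F1) = based_triples (collinear F2).
  apply/setP => -[[u v] w].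
  by rewrite (based_triplesE s1) (based_triplesE s2) e12 e13 e23.
apply: matroid_ext => // [x|x y z]; first by move/ffunP/(_ x): er; rewrite !ffunE.
by rewrite (col_based_triples s1) (col_based_triples s2) eQ.
Qed.

Lemma card_excl (T : finType) (s : nat) :
  (forall F, F \in excl T -> #|based_triples (collinear F)| <= s) ->
  #|excl T| <= #|T|.+1 ^ #|T| * #|[set A : {set T * T} | #|A| <= s]| ^ 3.
Proof.
move=> Qs; rewrite -(card_in_imset (@code_inj T)).
set B := [set A : {set T * T} | _].
apply: (@leq_trans #|setX (setX (setX [set: {ffun T -> option T}] B) B) B|).
  apply: subset_leq_card; apply/subsetP => _ /imsetP[F FE ->].
  by rewrite !inE /= !(leq_trans (leq_imset_card _ _) (Qs F FE)).
by rewrite !cardsX cardsT card_ffun card_option expnS expnS expn1 !mulnA.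
Qed.

(* count_excl n = 2^{o(n^2)}: for every k > 0, eventually
   log2 (count_excl n) <= n^2 / k, i.e. (count_excl n)^k <= 2^(n^2). *)
Theorem theorem3 :
  forall k : nat, 0 < k ->
  exists N0 : nat, forall n : nat, N0 <= n -> count_excl n ^ k <= 2 ^ (n * n).
Proof.
(* The goal is proved squared, with one factor 2^(n^2) for the representative map and one for the
   three pair sets. The latter needs B^(6k) <= 2^(n^2), which follows from B^K <= 4^(n^2) with K =
   12k; m is the density required by [card_small_sets_subexp]. *)
move=> k k0; pose K := 12 * k; pose m := 2 * K * K.
have K0 : 0 < K by rewrite muln_gt0.
have m0 : 0 < m by rewrite !muln_gt0 k0.
have [N1 rs] := corner_free_card m.
have [|N2 pe] := @poly_le_exp (2 * k); first by rewrite muln_gt0.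
exists (N1 + N2) => n nN.
have n1 : N1 <= n := leq_trans (leq_addr _ _) nN.
have n2 : N2 <= n := leq_trans (leq_addl _ _) nN.
pose s := (n * n) %/ m.
have hB : #|[set A : {set 'I_n * 'I_n} | #|A| <= s]| ^ K <= 4 ^ (n * n).
  have := @card_small_sets_subexp ('I_n * 'I_n)%type K s K0.
  by rewrite card_prod card_ord; apply; rewrite mulnC; apply: leq_divM.
have hE : count_excl n <= n.+1 ^ n * #|[set A : {set 'I_n * 'I_n} | #|A| <= s]| ^ 3.
  have := @card_excl 'I_n s; rewrite card_ord; apply => F.
  rewrite inE => /and4P[mF /eqP rF wF kF].
  have sp := col_triangle_free mF rF wF kF.
  apply: leq_trans (card_based_triples sp) _.
  have := rs _ _ _ (corner_free_cyc_triples sp); rewrite card_ord => /(_ n1) /ltnW h.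
  by rewrite leq_divRL // mulnC.
move: hB hE; set B := #|_| => hB hE.
have hB2 : (B ^ 3) ^ (2 * k) <= 2 ^ (n * n).
  rewrite -(leq_exp2r _ _ (isT : 0 < 2)) -!expnM [in X in _ <= X]mulnC [in X in _ <= X]expnM.
  by rewrite (_ : 3 * _ = K) // /K; lia.
have hR : (n.+1 ^ n) ^ (2 * k) <= 2 ^ (n * n).
  rewrite -expnM mulnC expnM [in X in _ <= X]expnM; have [->|np] := posnP n; first by [].
  by rewrite leq_exp2r // pe.
rewrite -(leq_exp2r _ _ (isT : 0 < 2)) -expnM (mulnC k 2).
apply: (@leq_trans ((n.+1 ^ n * B ^ 3) ^ (2 * k))); first by rewrite leq_exp2r // muln_gt0.
by rewrite expnMn (expnS _ 1) expn1 leq_mul.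
Qed.
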